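(* Let $\lambda=(\lambda_1,\dots,\lambda_k)$ be a composition of $n$. The poset $C_\lambda$ (with the restriction of the Bruhat-Chevalley order of $S_n$) is unimodal and rank-symmetric, and moreover $$\sum_{\pi\in C_\lambda}q^{inv(\pi)}=[i_1]_q[i_2]_q\cdots[i_m]_q$$ for a certain sequence of integers $2\le i_1<i_2<\cdots<i_m\le n-1$.
   Context: $S_n$ is the symmetric group on $[n]$. The standard cyclic form of $\pi\in S_n$ is its expression as a product of disjoint cycles, with cycles of length one NOT omitted, each cycle beginning with its smallest entry, and cycles ordered by increasing first entries; the composition type of $\pi$ is the sequence of cycle lengths in this order. $\Omega:S_n\to S_n$ sends $\pi$ to the permutation whose one-line notation is the word obtained by deleting the parentheses from the standard cyclic form of $\pi$. For $\lambda\vDash n$, $C_\lambda:=\Omega(A_\lambda)$ where $A_\lambda$ is the set of permutations of composition type $\lambda$. $inv(x)=|\{(i,j):i<j,\ x(i)>x(j)\}|$, and the Bruhat-Chevalley order on $S_n$ is the transitive closure of $x<y$ where $y$ is obtained from $x$ by swapping two entries $a_i<a_j$ at positions $i<j$ with $inv(y)=inv(x)+1$; $C_\lambda$ is graded with rank function $inv$. $[r]_q=1+q+\cdots+q^{r-1}$. If $r_i$ is the number of elements of rank $i$ and $M$ is the rank of the maximum, rank-symmetric means $r_i=r_{M-i}$ for all $i$, and unimodal means $r_0\le\cdots\le r_{\lfloor M/2\rfloor}\ge\cdots\ge r_M$. *)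

(* Defs.v *)
From mathcomp Require Import all_boot all_order all_algebra all_fingroup.

Set Implicit Arguments.
Unset Strict Implicit.
Unset Printing Implicit Defensive.

Import GRing.Theory.

(* [n] is encoded as 'I_n = {0, ..., n-1}; one-line notation of w is
   w 0, w 1, ..., w (n-1). *)

Definition is_composition (n : nat) (lam : seq nat) : Prop :=
  all (leq 1) lam /\ sumn lam = n.

Section StandardCyclicForm.
Variable n : nat.
Implicit Types p w : 'S_n.

Definition cycle_min p (x : 'I_n) : bool := [forall y in porbit p x, x <= y].

Definition cycle_word p (x : 'I_n) : seq 'I_n := traject p x #|porbit p x|.

(* enum 'I_n is increasing, so the cycles come in increasing order of their
   first (smallest) entries; fixed points give cycles of length one. *)
Definition standard_cyclic_form p : seq (seq 'I_n) :=
  [seq cycle_word p x | x <- enum 'I_n & cycle_min p x].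

Definition composition_type p : seq nat := shape (standard_cyclic_form p).

Definition Omega_word p : seq 'I_n := flatten (standard_cyclic_form p).

Lemma mem_cycle_word p x y : (y \in cycle_word p x) = (y \in porbit p x).
Proof. by rewrite /cycle_word porbit_traject. Qed.

Lemma mem_Omega_word p y : y \in Omega_word p.
Proof.
have yy : y \in porbit p y by rewrite porbit_id.
case: (arg_minnP (fun z : 'I_n => val z) yy) => x xy minx.
apply/flattenP; exists (cycle_word p x); last first.
  by rewrite mem_cycle_word porbit_sym.
apply/mapP; exists x => //.
rewrite mem_filter mem_enum andbT.
apply/forallP => z; apply/implyP => zx; apply: minx.
suff: z \in porbit p y by [].
have {}xy : x \in porbit p y := xy.
by move: zx xy; rewrite -!eq_porbit_mem => /eqP -> /eqP ->.
Qed.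

Lemma Omega_word_uniq p : uniq (Omega_word p).
Proof.
rewrite /Omega_word /standard_cyclic_form.
have : uniq [seq x <- enum 'I_n | cycle_min p x] by rewrite filter_uniq ?enum_uniq.
have : all (cycle_min p) [seq x <- enum 'I_n | cycle_min p x] by rewrite filter_all.
elim: [seq x <- _ | _] => //= x s IHs /andP[mx ms] /andP[xs us].
rewrite cat_uniq IHs // andbT uniq_traject_porbit /=.
apply/hasPn => y /flattenP[_ /mapP[z zs ->]].
rewrite mem_cycle_word => yz; apply/negP => /=; rewrite mem_cycle_word => yx.
have xz : porbit p x = porbit p z.
  by move: yx yz; rewrite -!eq_porbit_mem => /eqP <- /eqP <-.
have mz := allP ms z zs.
case/negP: xs; suff -> : x = z by [].
apply/val_inj/eqP; rewrite eqn_leq.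
move/forallP/(_ z)/implyP: mx; rewrite xz porbit_id => -> //.
by move/forallP/(_ x)/implyP: mz; rewrite -xz porbit_id => ->.
Qed.

Lemma size_Omega_word p : size (Omega_word p) = n.
Proof.
rewrite -(card_uniqP (Omega_word_uniq p)) -[RHS](card_ord n).
by apply: eq_card => y; rewrite mem_Omega_word.
Qed.

Definition Omega_fun p (i : 'I_n) : 'I_n := nth i (Omega_word p) i.

Lemma Omega_fun_inj p : injective (Omega_fun p).
Proof.
move=> i j; rewrite /Omega_fun (set_nth_default i j) ?size_Omega_word //.
by move/eqP; rewrite nth_uniq ?size_Omega_word ?Omega_word_uniq // => /eqP /val_inj.
Qed.

Definition Omega p : 'S_n := perm (@Omega_fun_inj p).

Lemma Omega_one_line p (x0 i : 'I_n) : Omega p i = nth x0 (Omega_word p) i.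
Proof.
by rewrite permE; apply: set_nth_default; rewrite size_Omega_word.
Qed.

Definition A_ (lam : seq nat) : {set 'S_n} := [set p | composition_type p == lam].

Definition C_ (lam : seq nat) : {set 'S_n} := Omega @: A_ lam.

Definition ninv w : nat :=
  #|[set ij : 'I_n * 'I_n | (ij.1 < ij.2) && (w ij.2 < w ij.1)]|.

(* (tperm i j * x) k = x (tperm i j k): the entries at positions i and j
   are exchanged. *)
Definition bruhat_step : rel 'S_n := fun x y =>
  [exists i : 'I_n, exists j : 'I_n,
     [&& i < j, x i < x j, y == (tperm i j * x)%g & ninv y == (ninv x).+1]].

Definition bruhat : rel 'S_n := connect bruhat_step.

End StandardCyclicForm.

Section RankedPosets.
(* The poset under consideration is the subset C with the restriction of le. *)
Variables (T : finType) (le : rel T) (rk : T -> nat) (C : {set T}).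

Definition minimal_in (x : T) : Prop :=
  x \in C /\ forall y, y \in C -> le y x -> y = x.

Definition maximum_in (x : T) : Prop :=
  x \in C /\ forall y, y \in C -> le y x.

Definition covers_in (x y : T) : Prop :=
  [/\ x \in C, y \in C, x != y, le x y
    & forall z, z \in C -> le x z -> le z y -> z = x \/ z = y].

Definition rank_function : Prop :=
  (forall x, minimal_in x -> rk x = 0) /\
  (forall x y, covers_in x y -> rk y = (rk x).+1).

Definition rank_number (i : nat) : nat := #|[set x in C | rk x == i]|.

Definition rank_symmetric : Prop :=
  rank_function /\
  exists2 m, maximum_in m &
    forall i, i <= rk m -> rank_number i = rank_number (rk m - i).

Definition rank_unimodal : Prop :=
  rank_function /\
  exists2 m, maximum_in m &
    (forall i, i < (rk m)./2 -> rank_number i <= rank_number i.+1) /\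
    (forall i, (rk m)./2 <= i < rk m -> rank_number i.+1 <= rank_number i).

End RankedPosets.

Definition qint (r : nat) : {poly int} := (\sum_(j < r) 'X^j)%R.

(* Main.v *)
Require Import Defs.
From mathcomp Require Import all_boot all_order all_algebra all_fingroup.
From mathcomp Require Import zify.

Set Implicit Arguments.
Unset Strict Implicit.
Unset Printing Implicit Defensive.

Import GRing.Theory Num.Theory Order.TTheory.

(* A permutation lies in C_lambda iff, once its word is cut into blocks of
   lengths lambda_i, the first letter of every block is smaller than all the
   letters to its right.  Hence the entries of its Lehmer code vanish at the
   block starts and are arbitrary elsewhere, which gives the product of
   q-integers; such a product is symmetric and unimodal.

   For gradedness, let x < y in C_lambda differ first at position a, and let
   b > a be the first position with x(a) < x(b) <= y(a).  Swapping the letters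
   of x at a and b gives a Bruhat cover of x below y, which is still in
   C_lambda because no letter in between has an intermediate value.  Similar
   swaps lead from any element of C_lambda up to the unique one whose letters
   off the block starts exceed all the letters to their right. *)

(** * Symmetric unimodal polynomials *)

Section SymmetricUnimodal.
Local Open Scope ring_scope.
Implicit Types p : {poly int}.

Definition sym_unimodal (d : nat) p : Prop :=
  [/\ forall i, (d < i)%N -> p`_i = 0,
      forall i, (i <= d)%N -> p`_i = p`_(d - i),
      forall i, 0 <= p`_i
    & forall i, (i.*2 < d)%N -> p`_i <= p`_i.+1].

Lemma sym_unimodal1 : sym_unimodal 0 1.
Proof.
split=> [i|i|i|//]; rewrite ?coef1 //; first by case: i.
by rewrite leqn0 => /eqP ->.
Qed.

Lemma sym_unimodal_le d p i j :
  sym_unimodal d p -> (i <= j)%N -> (i + j <= d)%N -> p`_i <= p`_j.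
Proof.
case=> p_out p_sym p_ge0 p_mono.
have mono k l : (k <= l)%N -> (l.*2 <= d.+1)%N -> p`_k <= p`_l.
  elim: l => [|l IHl]; first by rewrite leqn0 => /eqP ->.
  rewrite leq_eqVlt => /orP[/eqP -> //|kl] ld.
  by apply: le_trans (IHl kl _) (p_mono _ _); lia.
move=> ij ijd; have [jd|jd] := leqP j.*2 d.+1; first exact: mono.
by rewrite (p_sym j) //; [apply: mono; lia|lia].
Qed.

Lemma sym_unimodal_ge d p i :
  sym_unimodal d p -> (d./2 <= i < d)%N -> p`_i.+1 <= p`_i.
Proof.
move=> p_unimodal /andP[di id]; have [_ p_sym _ _] := p_unimodal.
by rewrite p_sym // (sym_unimodal_le p_unimodal) //; lia.
Qed.

Lemma size_sym_unimodal d p : sym_unimodal d p -> p`_0 != 0 -> size p = d.+1.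
Proof.
case=> p_out p_sym _ _ p_0_neq0.
have p_d_neq0 : p`_d != 0 by rewrite p_sym // subnn.
apply/eqP; rewrite eqn_leq; apply/andP; split.
  by apply/leq_sizeP => j /p_out.
by rewrite ltnNge; apply: contraNN p_d_neq0 => /leq_sizeP ->.
Qed.

Lemma coef_qintM r p i :
  (qint r * p)`_i = \sum_(j < r) (if (i < j)%N then 0 else p`_(i - j)).
Proof.
by rewrite /qint mulr_suml coef_sum; apply: eq_bigr => j _; rewrite coefXnM.
Qed.

Lemma coefS_qintM r p i :
  (qint r.+1 * p)`_i.+1 =
    (qint r.+1 * p)`_i + p`_i.+1 - (if (i < r)%N then 0 else p`_(i - r)).
Proof.
rewrite !coef_qintM big_ord_recl subn0 [in RHS]big_ord_recr /=.
by rewrite [RHS]addrAC addrK addrC.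
Qed.

Lemma sym_unimodal_qintM d r p :
  sym_unimodal d p -> sym_unimodal (d + r) (qint r.+1 * p).
Proof.
move=> p_unimodal; have [p_out p_sym p_ge0 _] := p_unimodal.
split=> [i di|i di|i|i di].
- rewrite coef_qintM big1 // => j _; case: ifP => // ij.
  by apply: p_out; have := ltn_ord j; lia.
- rewrite !coef_qintM (reindex_inj rev_ord_inj) /=; apply: eq_bigr => j _.
  have jr := ltn_ord j; case: ifP => ij; case: ifP => ij' //.
  + by rewrite p_out //; lia.
  + by rewrite p_out //; lia.
  + have [dij|dij] := leqP (i - (r.+1 - j.+1)) d; last by lia.
    by rewrite p_sym //; congr (p`_ _); lia.
- by rewrite coef_qintM sumr_ge0 // => j _; case: ifP.
- rewrite coefS_qintM -addrA lerDl subr_ge0; case: ifP => // ir.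
  by apply: sym_unimodal_le p_unimodal _ _; lia.
Qed.

Lemma sym_unimodal_prod_qint I (s : seq I) (P : pred I) (F : I -> nat) :
  (forall i, P i -> (0 < F i)%N) ->
  sym_unimodal (\sum_(i <- s | P i) (F i).-1) (\prod_(i <- s | P i) qint (F i)).
Proof.
move=> F_gt0; elim/big_rec2: _ => [|i d p Pi p_unimodal].
  exact: sym_unimodal1.
by case: (F i) (F_gt0 i Pi) => // r _; rewrite addnC; apply: sym_unimodal_qintM.
Qed.

End SymmetricUnimodal.

(** * Ranked posets *)

Definition rank_gf (T : finType) (rk : T -> nat) (C : {set T}) : {poly int} :=
  (\sum_(x in C) 'X^(rk x))%R.

Section RankGeneratingFunction.
Variables (T : finType) (le : rel T) (rk : T -> nat) (C : {set T}).

Lemma coef_rank_gf i : ((rank_gf rk C)`_i = (rank_number rk C i)%:R)%R.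
Proof.
rewrite /rank_gf coef_sum /rank_number -sum1_card natr_sum.
rewrite big_mkcond [RHS]big_mkcond /=.
apply: eq_bigr => w _; rewrite coefXn inE eq_sym.
by case: (w \in C); case: eqP.
Qed.

Lemma rank_number_gt0 x : x \in C -> 0 < rank_number rk C (rk x).
Proof. by move=> xC; apply/card_gt0P; exists x; rewrite inE xC eqxx. Qed.

Hypothesis rk_homo : forall x y, le x y -> rk x <= rk y.

Lemma size_rank_gf m : maximum_in le C m -> size (rank_gf rk C) = (rk m).+1.
Proof.
case=> mC m_max; apply/eqP; rewrite eqn_leq; apply/andP; split.
  apply/leq_sizeP => i lt_mi; apply/eqP; rewrite coef_rank_gf pnatr_eq0.
  apply: contraTT lt_mi; rewrite -lt0n -leqNgt => /card_gt0P[x].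
  by rewrite inE => /andP[/m_max/rk_homo le_xm /eqP <-].
rewrite ltnNge; apply/negP => /leq_sizeP/(_ _ (leqnn _))/eqP.
by rewrite coef_rank_gf pnatr_eq0 -leqn0 leqNgt rank_number_gt0.
Qed.

Lemma sym_unimodal_rank d x0 m :
  rank_function le rk C -> maximum_in le C m -> x0 \in C -> rk x0 = 0 ->
  sym_unimodal d (rank_gf rk C) ->
  rank_unimodal le rk C /\ rank_symmetric le rk C.
Proof.
move=> rkP mP x0C rkx0 p_unimodal; have [_ p_sym _ p_mono] := p_unimodal.
have rk_m : rk m = d.
  apply: succn_inj.
  rewrite -(size_rank_gf mP) (size_sym_unimodal p_unimodal) //.
  by have := rank_number_gt0 x0C; rewrite rkx0 coef_rank_gf pnatr_eq0 -lt0n.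
split; split=> //; exists m => //; rewrite rk_m; last first.
  by move=> i /p_sym/eqP; rewrite !coef_rank_gf eqr_nat => /eqP.
split=> i i_d; rewrite -(ler_nat int) -!coef_rank_gf.
  by apply: p_mono; lia.
exact: sym_unimodal_ge p_unimodal _.
Qed.

End RankGeneratingFunction.

(** * Bruhat order *)

Lemma bigD2 (R : Type) (idx : R) (op : Monoid.com_law idx) (I : finType)
    (a b : I) (F : I -> R) : a != b ->
  \big[op/idx]_i F i =
    op (op (F a) (F b)) (\big[op/idx]_(i | (i != a) && (i != b)) F i).
Proof.
by move=> neq_ab; rewrite (bigD1 a) //= (bigD1 b) 1?eq_sym //= Monoid.mulmA.
Qed.

Lemma sum_pairsD2 (I : finType) (a b : I) (F : I -> I -> nat) : a != b ->
  \sum_i \sum_j F i j =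
    F a a + F a b + F b a + F b b
    + \sum_(c | (c != a) && (c != b)) (F a c + F c a + F b c + F c b)
    + \sum_(c | (c != a) && (c != b)) \sum_(d | (d != a) && (d != b)) F c d.
Proof.
move=> neq_ab; rewrite !(bigD2 _ _ neq_ab) /=.
by rewrite (eq_bigr _ (fun c _ => bigD2 _ (F c) neq_ab)) !big_split /=; lia.
Qed.

Section Bruhat.
Variable n : nat.
Implicit Types (x y z w : 'S_n) (a b c d i j : 'I_n).

Lemma val_perm_eq w i j : (val (w i) == val (w j)) = (i == j).
Proof. by rewrite (inj_eq val_inj) (inj_eq perm_inj). Qed.

Definition inversion w i j : bool := (i < j) && (w j < w i).

Lemma ltn_ord_neq i j : i < j -> i != j.
Proof. by apply: contraTneq => ->; rewrite ltnn. Qed.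

Lemma ninvE w : ninv w = \sum_i \sum_j inversion w i j.
Proof.
rewrite /ninv -sum1_card pair_big /= big_mkcond /=.
by apply: eq_bigr => -[i j] _; rewrite inE /inversion /=; case: ifP.
Qed.

Lemma ninv1 : ninv (1%g : 'S_n) = 0.
Proof. by apply: eq_card0 => -[i j]; rewrite !inE /= !perm1; lia. Qed.

Lemma ninv_leq w : ninv w <= n * n.
Proof. by apply: leq_trans (max_card _) _; rewrite card_prod !card_ord. Qed.

Definition free_rise x a b : Prop :=
  [/\ a < b, x a < x b & forall c, a < c < b -> ~~ (x a < x c < x b)].

Lemma ninv_free_rise x a b :
  free_rise x a b -> ninv (tperm a b * x)%g = (ninv x).+1.
Proof.
case=> ab xab free; have neq_ab := ltn_ord_neq ab.
have swapE c : (c != a) && (c != b) -> (tperm a b * x)%g c = x c.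
  by case/andP=> ca cb; rewrite permM tpermD // eq_sym.
rewrite !ninvE !(sum_pairsD2 _ neq_ab) /inversion !permM tpermL tpermR !ltnn.
under [X in _ + _ + X]eq_bigr => c /swapE xc do
  under eq_bigr => d /swapE xd do rewrite xc xd.
rewrite (eq_bigr (fun c => inversion x a c + inversion x c a +
                           inversion x b c + inversion x c b)); last first.
  move=> c cab; rewrite swapE //; case/andP: cab => ca cb.
  have := free c; have := val_perm_eq x c a; have := val_perm_eq x c b.
  move: ca cb; rewrite -!(inj_eq val_inj) /inversion /=; lia.
rewrite /inversion /=; lia.
Qed.

Lemma bruhat_step_ninv x y : bruhat_step x y -> ninv y = (ninv x).+1.
Proof. by case/existsP=> i /existsP[j /and4P[_ _ _ /eqP]]. Qed.

Lemma free_rise_step x a b : free_rise x a b -> bruhat_step x (tperm a b * x)%g.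
Proof.
move=> rise; have [ab xab _] := rise.
apply/existsP; exists a; apply/existsP; exists b.
by rewrite ab xab eqxx ninv_free_rise // eqxx.
Qed.

Lemma bruhat_ninv x y : bruhat x y -> ninv x <= ninv y.
Proof.
case/connectP=> s; elim: s x => [|z s IHs] x /=; first by move=> _ ->.
by case/andP=> /bruhat_step_ninv xz /IHs{}IHs /IHs; rewrite xz => /ltnW.
Qed.

Lemma bruhat_step_ind (Q : 'S_n -> Prop) :
  (forall x, (forall z, bruhat_step x z -> Q z) -> Q x) -> forall x, Q x.
Proof.
move=> stepQ x; have [k] := ubnP (n * n - ninv x); elim: k x => // k IHk x lek.
apply: stepQ => z /bruhat_step_ninv xz; apply: IHk.
by have := ninv_leq z; lia.
Qed.

(* The number w[k, v] of the tableau criterion for Bruhat order. *)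
Definition corner w (k v : nat) : nat := \sum_(i : 'I_n | i < k) (v <= w i).

Definition corner_le x y : Prop := forall k v, corner x k v <= corner y k v.

Lemma corner_tperm x a b k v : a < b -> x a < x b ->
  corner (tperm a b * x)%g k v =
    corner x k v + ((a < k <= b) && (x a < v <= x b)).
Proof.
move=> ab xab; have neq_ab := ltn_ord_neq ab.
rewrite /corner !(big_mkcond (fun i : 'I_n => i < k)) /= !(bigD2 _ _ neq_ab) /=.
rewrite !permM tpermL tpermR.
under eq_bigr => c /andP[ca cb].
  rewrite permM tpermD 1?eq_sym //; over.
move: (\sum_(c | _) _) => rest; by do 2 case: ifP; lia.
Qed.

Lemma bruhat_corner_le x y : bruhat x y -> corner_le x y.
Proof.
case/connectP=> s; elim: s x => [|z s IHs] x /=; first by move=> _ -> k v.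
case/andP=> /existsP[i /existsP[j /and4P[ij xij /eqP zE _]]].
move=> /IHs{}IHs /IHs zy k v.
by apply: leq_trans (zy k v); rewrite zE corner_tperm // leq_addr.
Qed.

Lemma corner_le1 y : corner_le 1%g y.
Proof.
move=> k v; rewrite /corner; case: (leqP k v) => [kv|vk].
  by rewrite big1 // => i ik; rewrite perm1 leqNgt (leq_trans ik kv).
have below_v : \sum_(i : 'I_n) (i < v) = \sum_(i : 'I_n) (y i < v).
  exact: reindex_inj (@perm_inj _ y).
rewrite -(leq_add2r (\sum_(i : 'I_n) (i < v))) {2}below_v.
rewrite !(big_mkcond (fun i : 'I_n => i < k)) -!big_split /=.
apply: leq_sum => i _; rewrite perm1; case: ifP; lia.
Qed.

Section FirstDifference.
Variables (x y : 'S_n) (a : 'I_n).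
Hypothesis agree : forall i, i < a -> x i = y i.

Lemma first_difference_later :
  x a != y a -> exists2 c : 'I_n, a < c & x c = y a.
Proof.
move=> xya; exists (x^-1%g (y a)); last by rewrite permKV.
rewrite ltnNge leq_eqVlt negb_or; apply/andP; split.
  by apply: contraNN xya => /eqP/val_inj a_eq; rewrite -{1}a_eq permKV.
apply/negP => ca; have := agree ca; rewrite permKV => /perm_inj a_eq.
by rewrite -a_eq ltnn in ca.
Qed.

Lemma corner_le_first_difference : corner_le x y -> x a <= y a.
Proof.
move=> /(_ a.+1 (x a)).
rewrite /corner (bigD1 a) //= [leqRHS](bigD1 a) //= leqnn.
rewrite (eq_bigr (fun i => nat_of_bool (x a <= y i))).
  by rewrite leq_add2r lt0b.
by move=> i /andP[ia neq_ia]; rewrite (@agree i) // ltn_neqAle neq_ia.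
Qed.

(* Compare the letters with values in [v, y a] at the positions below k: before
   a they are the same for x and y, at a only y has one, later x has none. *)
Lemma corner_le_tperm_first_difference b :
  corner_le x y -> a < b -> x a < x b <= y a ->
  (forall c, a < c < b -> ~~ (x a < x c <= y a)) ->
  corner_le (tperm a b * x)%g y.
Proof.
move=> le_xy ab /andP[xab xby] gap k v; rewrite corner_tperm //.
case: (boolP (_ && _)) => [|_]; last by rewrite addn0.
case/andP=> [/andP[ak kb] /andP[xav vxb]].
suff: corner x k v + corner y k (y a).+1 + 1 <=
      corner y k v + corner x k (y a).+1.
  by have := le_xy k (y a).+1; lia.
have -> : 1 = \sum_(i : 'I_n | i < k) (i == a).
  by rewrite (bigD1 a) //= eqxx big1 // => i /andP[_ /negbTE ->].
rewrite -!big_split /=; apply: leq_sum => i ik.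
case: (ltngtP i a) => [ia|ai|/val_inj ->]; last by rewrite eqxx /=; lia.
  by rewrite agree // (negbTE (ltn_ord_neq ia)) addn0.
by rewrite eq_sym (negbTE (ltn_ord_neq ai)) /=; have := gap i; lia.
Qed.

End FirstDifference.

Lemma first_difference x y : x != y ->
  exists a, [/\ x a != y a, forall i, i < a -> x i = y i,
                exists2 c : 'I_n, a < c & y c = x a
              & exists2 d : 'I_n, a < d & x d = y a].
Proof.
move=> neq_xy; have /existsP[a0 xya0] : [exists i, x i != y i].
  apply: contraNT neq_xy; rewrite negb_exists => /forallP eq_xy.
  by apply/eqP/permP => i; apply/eqP; rewrite -[_ == _]negbK.
have [a xya a_min] := @arg_minnP _ a0 (fun i => x i != y i) val xya0.
have agree i : i < a -> x i = y i.
  by move=> ia; apply/eqP; apply: contraTT ia => /a_min; rewrite -leqNgt.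
exists a; split=> //; last exact: first_difference_later.
by apply: first_difference_later => [i /agree|]; rewrite // eq_sym.
Qed.

Lemma ex_free_rise x a d : a < d -> x a < x d ->
  exists b, [/\ free_rise x a b, x b <= x d
              & forall c, a < c < b -> ~~ (x a < x c <= x d)].
Proof.
move=> ad xad.
have dP : (a < d) && (x a < x d <= x d) by rewrite ad xad leqnn.
have [b /and3P[ab xab xbd] b_min] :=
  @arg_minnP _ d (fun b : 'I_n => (a < b) && (x a < x b <= x d)) val dP.
have gap c : a < c < b -> ~~ (x a < x c <= x d).
  case/andP=> ac; apply: contraTN => xc.
  by rewrite -leqNgt; apply: b_min; rewrite ac.
by exists b; split=> //; split=> // c /gap; lia.
Qed.

End Bruhat.

(** * Permutations with prescribed right-to-left minima *)

Section RightToLeftMinima.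
Variable n : nat.
Implicit Types (x y z w : 'S_n) (a b c d i j : 'I_n) (P : pred nat).

Definition rlmin_set P : {set 'S_n} :=
  [set w : 'S_n |
    [forall i : 'I_n, forall j : 'I_n, P i && (i < j) ==> (w i < w j)]].

Lemma rlmin_setP P w :
  reflect (forall i j, P i -> i < j -> w i < w j) (w \in rlmin_set P).
Proof.
rewrite inE; apply: (iffP forallP) => wP i.
  by move=> j Pi ij; move/forallP/(_ j)/implyP: (wP i); rewrite Pi ij; apply.
by apply/forallP => j; apply/implyP => /andP[]; apply: wP.
Qed.

Lemma rlmin_set1 P : 1%g \in rlmin_set P.
Proof. by apply/rlmin_setP => i j _; rewrite !perm1. Qed.

Lemma rlmin_set_tperm P x a b :
  x \in rlmin_set P -> ~~ P a -> free_rise x a b ->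
  (tperm a b * x)%g \in rlmin_set P.
Proof.
move=> /rlmin_setP xP Pa [ab xab free]; apply/rlmin_setP => i j Pi ij.
rewrite !permM; have neq_ia : i != a by apply: contraNneq Pa => <-.
have [ib|neq_ib] := eqVneq i b.
  rewrite ib in Pi ij *; have aj := ltn_trans ab ij.
  rewrite tpermR tpermD ?ltn_ord_neq //.
  exact: ltn_trans xab (xP _ _ Pi ij).
rewrite (tpermD (z := i)) 1?eq_sym //.
have xij := xP i j Pi ij; case: tpermP => [ja|jb|//].
  by rewrite ja in xij; lia.
rewrite jb in ij xij.
have := xP i a Pi; have := free i; have := val_perm_eq x i a.
by rewrite (negbTE neq_ia); move: neq_ia; rewrite -(inj_eq val_inj) /=; lia.
Qed.

Lemma rlmin_set_interpolate P x y :
  x \in rlmin_set P -> y \in rlmin_set P -> corner_le x y -> x != y ->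
  exists z, [/\ z \in rlmin_set P, bruhat_step x z & corner_le z y].
Proof.
move=> xP /rlmin_setP yP le_xy.
case/first_difference=> a [xya agree [c ac yc] [d ad xd]].
have lt_xya : x a < y a.
  rewrite ltn_neqAle (inj_eq val_inj) xya.
  exact: corner_le_first_difference agree le_xy.
have Pa : ~~ P a by apply/negP => Pa; have := yP a c Pa ac; rewrite yc; lia.
have xad : x a < x d by rewrite xd.
have [b [rise]] := ex_free_rise ad xad; rewrite xd => xbd gap.
have [ab xab _] := rise; exists (tperm a b * x)%g; split.
- exact: rlmin_set_tperm.
- exact: free_rise_step.
- by apply: corner_le_tperm_first_difference; rewrite ?xab.
Qed.

Lemma bruhat_cornerP x y : bruhat x y <-> corner_le x y.
Proof.
split; first exact: bruhat_corner_le.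
move: x; apply: bruhat_step_ind => x IHx le_xy.
have [->|neq_xy] := eqVneq x y; first exact: connect0.
have all_rlmin w : w \in rlmin_set pred0 by apply/rlmin_setP.
have [z [_ xz zy]] :=
  rlmin_set_interpolate (all_rlmin x) (all_rlmin y) le_xy neq_xy.
exact: connect_trans (connect1 xz) (IHx z xz zy).
Qed.

Lemma rlmin_set_rank_function P :
  rank_function (@bruhat n) (@ninv n) (rlmin_set P).
Proof.
split=> [x [_ x_min]|x y [xP yP neq_xy /bruhat_cornerP le_xy cover_xy]].
  rewrite -(x_min _ (rlmin_set1 P)) ?ninv1 //.
  exact/bruhat_cornerP/corner_le1.
have [z [zP xz /bruhat_cornerP zy]] := rlmin_set_interpolate xP yP le_xy neq_xy.
have ninv_z := bruhat_step_ninv xz; rewrite -ninv_z.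
case: (cover_xy z zP (connect1 xz) zy) => [zx|-> //].
by rewrite zx in ninv_z; lia.
Qed.

Definition rl_extremal P w : Prop := forall i j, i < j -> (w i < w j) = P i.

Lemma rl_extremal_uniq P x y : rl_extremal P x -> rl_extremal P y -> x = y.
Proof.
move=> xP yP; apply/eqP/negPn/negP.
case/first_difference=> a [xya _ [c ac yc] [d ad xd]].
have := xP a d ad; have := yP a c ac; rewrite xd yc.
by move: xya; rewrite -(inj_eq val_inj) /=; lia.
Qed.

Lemma rl_extremal_above P x :
  x \in rlmin_set P -> exists2 m, rl_extremal P m & bruhat x m.
Proof.
move: x; apply: bruhat_step_ind => x IHx xP.
case: (boolP [exists i : 'I_n, exists j : 'I_n,
                [&& ~~ P i, i < j & x i < x j]]).
  case/existsP=> a /existsP[d /and3P[Pa ad xad]].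
  have [b [rise _ _]] := ex_free_rise ad xad.
  have xz := free_rise_step rise.
  have [m mP zm] := IHx _ xz (rlmin_set_tperm xP Pa rise).
  by exists m => //; apply: connect_trans (connect1 xz) zm.
move=> no_rise; exists x; last exact: connect0.
move=> i j ij; case: (boolP (P i)) => Pi; first exact: (rlmin_setP _ _ xP).
apply: contraNF no_rise => xij.
by apply/existsP; exists i; apply/existsP; exists j; rewrite Pi ij.
Qed.

Lemma rlmin_set_maximum P : exists m, maximum_in (@bruhat n) (rlmin_set P) m.
Proof.
have [m mP _] := rl_extremal_above (rlmin_set1 P); exists m; split.
  by apply/rlmin_setP => i j Pi ij; rewrite mP.
by move=> y /rl_extremal_above[m' m'P]; rewrite (rl_extremal_uniq m'P mP).
Qed.

End RightToLeftMinima.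

(** * Generating function *)

Lemma lift_perm_inj n (i v : 'I_n.+1) : injective (@lift_perm n i v).
Proof.
move=> s t eq_st; apply/permP => k; apply: (@lift_inj _ v).
by rewrite -!(lift_perm_lift i) eq_st.
Qed.

Lemma lift_perm_bij n (i : 'I_n.+1) :
  bijective (fun vs : 'I_n.+1 * 'S_n => lift_perm i vs.1 vs.2).
Proof.
apply: inj_card_bij => [[v s] [v' s'] /= eq_vs|]; last first.
  by rewrite card_prod card_ord !card_Sn factS.
have eq_v : v = v' by rewrite -(lift_perm_id i v s) eq_vs lift_perm_id.
by move: eq_vs; rewrite eq_v => /lift_perm_inj ->.
Qed.

Lemma ltn_lift n (v : 'I_n.+1) (i j : 'I_n) : (lift v i < lift v j) = (i < j).
Proof. by rewrite /= /bump; lia. Qed.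

Lemma sum_ltn_ord n k : k <= n -> \sum_(j < n) (j < k) = k.
Proof.
move=> kn; rewrite -big_mkcond -(big_ord_widen n (fun=> 1) kn).
by rewrite sum1_card card_ord.
Qed.

Lemma ninv_lift_perm n (v : 'I_n.+1) (s : 'S_n) :
  ninv (lift_perm ord0 v s) = v + ninv s.
Proof.
rewrite !ninvE big_ord_recl; congr (_ + _); last first.
  apply: eq_bigr => i _; rewrite big_ord_recl add0n.
  by apply: eq_bigr => j _; rewrite /inversion !lift_perm_lift !ltn_lift.
rewrite big_ord_recl add0n -[RHS](@sum_ltn_ord n) -1?ltnS //.
rewrite [RHS](reindex_inj (@perm_inj _ s)); apply: eq_bigr => j _.
by rewrite /inversion lift_perm_id lift_perm_lift /= /bump; lia.
Qed.

Lemma lift_perm_rlmin_set n (P : pred nat) (v : 'I_n.+1) (s : 'S_n) :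
  (lift_perm ord0 v s \in rlmin_set _ P) =
  (P 0 ==> (v == ord0)) && (s \in rlmin_set _ (fun i => P i.+1)).
Proof.
apply/rlmin_setP/andP => [wP|[/implyP v0 /rlmin_setP sP] i j].
  split; last first.
    apply/rlmin_setP => i j Pi ij; have := wP (lift ord0 i) (lift ord0 j) Pi.
    by rewrite !lift_perm_lift !ltn_lift; apply.
  apply/implyP => P0; case: (unliftP v ord0) => [k v_gt0|->] //.
  have := wP ord0 (lift ord0 (s^-1%g k)) P0 isT.
  by rewrite lift_perm_id lift_perm_lift permKV -v_gt0.
case: (unliftP ord0 i) => [i' ->|->]; case: (unliftP ord0 j) => [j' ->|->] //.
  by rewrite !lift_perm_lift !ltn_lift; apply: sP.
by rewrite lift_perm_lift lift_perm_id => /v0/eqP ->.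
Qed.

Lemma rlmin_set_gfS n (P : pred nat) :
  (rank_gf (@ninv _) (rlmin_set n.+1 P) =
   (if P 0 then 1 else qint n.+1) *
   rank_gf (@ninv _) (rlmin_set n (fun i => P i.+1)))%R.
Proof.
rewrite /rank_gf (reindex _ (onW_bij _ (lift_perm_bij ord0))) /=.
under eq_bigl => vs do rewrite lift_perm_rlmin_set.
under eq_bigr => vs _ do rewrite ninv_lift_perm exprD.
rewrite -(pair_big (fun v => P 0 ==> (v == ord0)) (fun s => s \in _)
  (fun v s => 'X^v * 'X^(ninv s))%R) -big_distrlr /=; congr (_ * _)%R.
by case: (P 0) => //=; rewrite big_pred1_eq expr0.
Qed.

Lemma rlmin_set_gf n (P : pred nat) :
  rank_gf (@ninv _) (rlmin_set n P) = (\prod_(i < n | ~~ P i) qint (n - i))%R.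
Proof.
elim: n P => [|n IHn] P.
  rewrite big_ord0 /rank_gf (eq_bigl (pred1 1%g)) ?big_pred1_eq ?ninv1 // => w.
  have -> : w = 1%g by apply/permP => -[].
  by rewrite rlmin_set1 /= eqxx.
rewrite rlmin_set_gfS IHn big_mkcond [RHS]big_mkcond big_ord_recl subn0 /=.
by congr (_ * _)%R; case: (P 0).
Qed.

Lemma qint1 : qint 1 = 1%R.
Proof. by rewrite /qint big_ord_recl big_ord0 expr0 addr0. Qed.

(* The factor i = 0 is absent since P 0, and the factor i = n - 1 is 1. *)
Lemma prod_qint_iota n (P : pred nat) : (0 < n -> P 0) ->
  (\prod_(i < n | ~~ P i) qint (n - i) =
   \prod_(r <- [seq r <- iota 2 (n - 2) | ~~ P (n - r)%N]) qint r)%R.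
Proof.
case: n => [|[|n]] P0; rewrite big_filter; first by rewrite big_ord0 big_nil.
  by rewrite big_nil big_mkcond big_ord1 P0.
rewrite -(big_mkord (fun i => ~~ P i) (fun i => qint (n.+2 - i))).
rewrite big_ltn_cond // P0 //=.
rewrite big_nat_rev big_ltn_cond //= -/(index_iota 2 n.+2).
have -> : n.+2 - (1 + n.+2 - 2) = 1 by lia.
rewrite qint1 mul1r if_same; apply: congr_big_nat => // i /and3P[_ _ lt_i].
by congr qint; lia.
Qed.

(** * Words cut into blocks *)

Definition block_start (lam : seq nat) : pred nat :=
  [pred i | i \in [seq sumn (take k lam) | k <- iota 0 (size lam)]].

Lemma block_start_cons a lam i :
  block_start (a :: lam) i = (i == 0) || (a <= i) && block_start lam (i - a).
Proof.
rewrite /block_start /= inE -(addn0 1) iotaDl -map_comp; congr (_ || _).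
apply/mapP/andP => [[k kP ->]|[ai /mapP[k kP i_a]]].
  by rewrite leq_addr addKn; split=> //; apply: map_f.
by exists k; rewrite //= -i_a subnKC.
Qed.

Section LeadingMinima.
Variables (T : Type) (r : rel T).

Fixpoint leading_minima (ss : seq (seq T)) : bool :=
  if ss is s :: ss' then
    (if s is x :: t then all (r x) (t ++ flatten ss') else false)
      && leading_minima ss'
  else true.

Lemma leading_minimaP (ss : seq (seq T)) : all (leq 1) (shape ss) ->
  reflect (forall x0 i j,
             block_start (shape ss) i -> i < j -> j < size (flatten ss) ->
             r (nth x0 (flatten ss) i) (nth x0 (flatten ss) j))
          (leading_minima ss).
Proof.
elim: ss => [|[//|x t] ss IHss] /=; first by left.
move=> /IHss{}IHss.
apply: (iffP andP) => [[/all_nthP x_min /IHss ss_min] x0 i j|uP].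
  rewrite block_start_cons => /orP[/eqP ->|/andP[ti ss_i]] ij ju.
    by case: j => // j in ij ju *; apply: x_min.
  have tj := leq_trans ti (ltnW ij).
  rewrite -!cat_cons !nth_cat /= !ltnS (leqNgt i) (leqNgt j) ti tj.
  apply: ss_min => //; first lia.
  by move: ju; rewrite size_cat; lia.
split; first by apply/(all_nthP x) => j ju; apply: (uP x 0 j.+1).
apply/IHss => x0 i j ss_i ij ju.
have := uP x0 ((size t).+1 + i) ((size t).+1 + j).
rewrite block_start_cons leq_addr addKn ss_i orbT.
rewrite -!cat_cons !nth_cat size_cat /=.
have lt_add k : ((size t).+1 + k < (size t).+1) = false.
  by rewrite ltnNge leq_addr.
by rewrite !lt_add !addKn; apply=> //; lia.
Qed.

End LeadingMinima.

Section NextInBlock.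
Variables (T : eqType) (ss : seq (seq T)).
Implicit Types (s : seq T) (y : T).

Definition block_of y : seq T := nth [::] ss (find (fun s => y \in s) ss).

Definition next_in_block y : T := next (block_of y) y.

Hypothesis uniq_ss : uniq (flatten ss).

Lemma uniq_block s : s \in ss -> uniq s.
Proof.
move: uniq_ss; elim: ss => //= t ss' IHss.
rewrite cat_uniq inE => /and3P[ut _ /IHss s_ss'].
by case/orP=> [/eqP ->|].
Qed.

Lemma block_ofE s y : s \in ss -> y \in s -> block_of y = s.
Proof.
rewrite /block_of; move: uniq_ss; elim: ss => //= t ss' IHss.
rewrite cat_uniq => /and3P[_ disj uniq_ss'].
rewrite inE => /orP[/eqP ->|s_ss'] ys; first by rewrite ys.
case: ifP => [yt|_] /=; last exact: IHss.
by case/hasP: disj; exists y => //; apply/flattenP; exists s.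
Qed.

Lemma fcycle_next_in_block s : s \in ss -> fcycle next_in_block s.
Proof.
move=> s_ss; have nextE : {in mem s &, frel (next s) =2 frel next_in_block}.
  by move=> y z ys _; rewrite /= /next_in_block (block_ofE s_ss ys).
by rewrite -(eq_in_cycle nextE) ?cycle_next ?uniq_block //; apply/allP.
Qed.

Lemma next_in_block_inj :
  (forall y, y \in flatten ss) -> injective next_in_block.
Proof.
move=> full; apply: (can_inj (g := fun y => prev (block_of y) y)) => y.
have /flattenP[s s_ss ys] := full y; rewrite /next_in_block (block_ofE s_ss ys).
by rewrite (block_ofE s_ss) ?mem_next // prev_next ?uniq_block.
Qed.

End NextInBlock.

(** * The standard cyclic form *)

Lemma mem_porbit_fconnect (T : finType) (p : {perm T}) x y :
  (y \in porbit p x) = fconnect p x y.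
Proof.
apply/porbitP/idP => [[i ->]|xy]; first by rewrite permX fconnect_iter.
by exists (findex p x y); rewrite permX iter_findex.
Qed.

Section CyclicForm.
Variable n : nat.
Implicit Types (p w : 'S_n) (x y z : 'I_n).
Implicit Types (s h : seq 'I_n) (ss : seq (seq 'I_n)).

Definition ord_lt : rel 'I_n := fun i j => i < j.

Lemma ord_lt_trans : transitive ord_lt.
Proof. by move=> j i k; apply: ltn_trans. Qed.

Lemma cycle_word_fcycle p x s :
  uniq (x :: s) -> fcycle p (x :: s) -> cycle_word p x = x :: s.
Proof.
move=> uniq_s cyc; have orbitE : porbit p x =i x :: s.
  by move=> y; rewrite mem_porbit_fconnect (fconnect_cycle cyc) ?mem_head.
rewrite /cycle_word (eq_card orbitE) (card_uniqP uniq_s) /=.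
by move: cyc; rewrite /= rcons_path => /andP[/fpathE sE _]; rewrite -sE.
Qed.

Lemma cycle_word_cons p x : exists2 s, cycle_word p x = x :: s & x \notin s.
Proof.
have := uniq_traject_porbit p x; rewrite /cycle_word.
case: #|_| (card_porbit_neq0 p x) => // k _ /= /andP[x_notin _].
by exists (traject p (p x) k).
Qed.

Lemma cycle_min_le p x y : cycle_min p x -> y \in cycle_word p x -> x <= y.
Proof. by move=> /forallP/(_ y)/implyP x_min; rewrite mem_cycle_word. Qed.

Lemma leading_minima_cycle_words p h :
  pairwise ord_lt h -> all (cycle_min p) h ->
  leading_minima ord_lt [seq cycle_word p x | x <- h].
Proof.
elim: h => //= x h IHh /andP[/allP xh h_lt] /andP[x_min h_min].
have [s xsE x_notin] := cycle_word_cons p x; rewrite xsE IHh // andbT all_cat.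
apply/andP; split; apply/allP => y.
  move=> ys; have le_xy : x <= y.
    by apply: cycle_min_le x_min _; rewrite xsE inE ys orbT.
  rewrite /ord_lt ltn_neqAle le_xy andbT.
  by rewrite (inj_eq val_inj); apply: contraNneq x_notin => ->.
case/flattenP=> _ /mapP[z zh ->] yz.
exact: leq_trans (xh z zh) (cycle_min_le (allP h_min z zh) yz).
Qed.

Lemma cycle_mins_sorted p : sorted ord_lt [seq x <- enum 'I_n | cycle_min p x].
Proof.
apply: (sorted_filter ord_lt_trans).
by have := iota_ltn_sorted 0 n; rewrite -val_enum_ord sorted_map.
Qed.

Lemma leading_minima_standard_cyclic_form p :
  leading_minima ord_lt (standard_cyclic_form p).
Proof.
apply: leading_minima_cycle_words; last exact: filter_all.
by rewrite -(sorted_pairwise ord_lt_trans) cycle_mins_sorted.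
Qed.

Lemma leading_minima_heads p ss : leading_minima ord_lt ss ->
  (forall x s, x :: s \in ss -> cycle_word p x = x :: s) ->
  exists h, [/\ ss = [seq cycle_word p x | x <- h],
                pairwise ord_lt h & all (cycle_min p) h].
Proof.
elim: ss => [|[|x s] ss IHss] //=; first by exists [::].
rewrite all_cat => /andP[/andP[/allP xs /allP xss] ss_min] cwE.
have [|h [hE h_lt h_min]] := IHss ss_min.
  by move=> y t y_ss; apply: cwE; rewrite inE y_ss orbT.
have xE := cwE x s (mem_head _ _).
exists (x :: h); split=> /=; first by rewrite xE -hE.
  rewrite h_lt andbT; apply/allP => y yh; apply: xss; rewrite hE.
  apply/flattenP; exists (cycle_word p y); first exact: map_f.
  by rewrite mem_cycle_word porbit_id.
rewrite h_min andbT; apply/forallP => z; apply/implyP.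
by rewrite -mem_cycle_word xE inE => /orP[/eqP -> //|/xs/ltnW].
Qed.

Lemma standard_cyclic_form_cycle_words p h :
  pairwise ord_lt h -> all (cycle_min p) h ->
  (forall y, y \in flatten [seq cycle_word p x | x <- h]) ->
  standard_cyclic_form p = [seq cycle_word p x | x <- h].
Proof.
move=> h_lt /allP h_min full; congr map.
apply: (irr_sorted_eq ord_lt_trans) => [i| | |x]; first exact: ltnn.
- exact: cycle_mins_sorted.
- by rewrite (sorted_pairwise ord_lt_trans).
rewrite mem_filter mem_enum andbT; apply/idP/idP => [x_min|/h_min //].
have /flattenP[_ /mapP[z zh ->] xz] := full x.
suff -> : x = z by [].
apply/val_inj/eqP; rewrite eqn_leq (cycle_min_le (h_min z zh) xz) andbT.
by rewrite (cycle_min_le x_min) // mem_cycle_word porbit_sym -mem_cycle_word.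
Qed.

Lemma ex_standard_cyclic_form ss :
  uniq (flatten ss) -> (forall y, y \in flatten ss) ->
  leading_minima ord_lt ss ->
  exists p, standard_cyclic_form p = ss.
Proof.
move=> uniq_ss full ss_min; pose p := perm (next_in_block_inj uniq_ss full).
exists p.
have [x s xs_ss|h [hE h_lt h_min]] := @leading_minima_heads p _ ss_min.
  apply: cycle_word_fcycle; first exact: uniq_block uniq_ss _ xs_ss.
  rewrite (eq_fcycle (f' := next_in_block ss)); last exact: permE.
  exact: fcycle_next_in_block.
by rewrite hE; apply: standard_cyclic_form_cycle_words; rewrite -?hE.
Qed.

Lemma nth_codom_ord (T : Type) (f : 'I_n -> T) (x0 : T) (i : 'I_n) :
  nth x0 (codom f) i = f i.
Proof. by rewrite (nth_map i) ?size_enum_ord // nth_ord_enum. Qed.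

Lemma size_codom_ord (T : Type) (f : 'I_n -> T) : size (codom f) = n.
Proof. by rewrite size_codom card_ord. Qed.

Lemma codom_perm_inj : injective (fun w : 'S_n => codom w).
Proof.
by move=> w w' eq_ww'; apply/permP => i; rewrite -!(nth_codom_ord _ i) eq_ww'.
Qed.

Lemma codom_Omega p : codom (Omega p) = Omega_word p.
Proof.
have eq_size : size (codom (Omega p)) = size (Omega_word p).
  by rewrite size_codom_ord size_Omega_word.
case word_eq: (Omega_word p) (eq_size) => [|x0 s] ?; first exact: size0nil.
rewrite -{}word_eq; apply: (eq_from_nth (x0 := x0)) => // i.
rewrite size_codom_ord => i_n.
by rewrite (nth_codom_ord _ _ (Ordinal i_n)) (Omega_one_line _ x0).
Qed.

Section Composition.
Variable lam : seq nat.
Hypothesis lam_comp : is_composition n lam.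

Lemma block_start0 : 0 < n -> block_start lam 0.
Proof.
case: lam_comp; case: (lam) => [|a l] _; first by move=> <-.
by rewrite block_start_cons.
Qed.

Lemma sumn_composition w : sumn lam = size (codom w).
Proof. by case: lam_comp => _ ->; rewrite size_codom_ord. Qed.

Lemma flatten_reshape_codom w : flatten (reshape lam (codom w)) = codom w.
Proof. by rewrite reshapeKr // (sumn_composition w). Qed.

Lemma shape_reshape_codom w : shape (reshape lam (codom w)) = lam.
Proof. by rewrite reshapeKl // (sumn_composition w). Qed.

Lemma mem_C w :
  (w \in C_ n lam) = leading_minima ord_lt (reshape lam (codom w)).
Proof.
apply/imsetP/idP => [[p]|w_min].
  rewrite inE => /eqP <- ->; rewrite codom_Omega flattenK.
  exact: leading_minima_standard_cyclic_form.
have [||p pE] := ex_standard_cyclic_form _ _ w_min;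
  rewrite ?flatten_reshape_codom.
- by rewrite map_inj_uniq ?enum_uniq //; apply: perm_inj.
- by move=> y; apply/codomP; exists (w^-1%g y); rewrite permKV.
exists p; first by rewrite inE /composition_type pE shape_reshape_codom.
apply: codom_perm_inj.
by rewrite codom_Omega /Omega_word pE flatten_reshape_codom.
Qed.

Lemma mem_rlmin_set_block_start w :
  (w \in rlmin_set n (block_start lam)) =
  leading_minima ord_lt (reshape lam (codom w)).
Proof.
have [lam_pos _] := lam_comp; apply/rlmin_setP/leading_minimaP;
  rewrite ?shape_reshape_codom ?flatten_reshape_codom ?size_codom_ord // => wP.
  move=> x0 i j i_start ij jn; have i_n := ltn_trans ij jn.
  have := wP (Ordinal i_n) (Ordinal jn) i_start ij.
  by rewrite -!(nth_codom_ord w x0).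
move=> i j i_start ij; have := wP i i j i_start ij (ltn_ord j).
by rewrite !nth_codom_ord.
Qed.

Lemma C_rlmin_set : C_ n lam = rlmin_set n (block_start lam).
Proof. by apply/setP => w; rewrite mem_C mem_rlmin_set_block_start. Qed.

End Composition.

End CyclicForm.

Theorem theoremB (n : nat) (lam : seq nat) (hlam : is_composition n lam) :
  [/\ rank_unimodal (@bruhat n) (@ninv n) (C_ n lam),
      rank_symmetric (@bruhat n) (@ninv n) (C_ n lam)
    & exists s : seq nat,
        [/\ sorted ltn s,
            all (fun i => 2 <= i <= n - 1) s
          & (\sum_(w in C_ n lam) 'X^(ninv w) = \prod_(i <- s) qint i :> {poly int})%R]].
Proof.
rewrite (C_rlmin_set hlam); set P := block_start lam.
have [m m_max] := rlmin_set_maximum n P.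
have gf_unimodal : sym_unimodal (\sum_(i < n | ~~ P i) (n - i).-1)
                       (rank_gf (@ninv n) (rlmin_set n P)).
  rewrite rlmin_set_gf; apply: sym_unimodal_prod_qint => i _.
  by rewrite subn_gt0.
have [unimodal symmetric] := sym_unimodal_rank (@bruhat_ninv n)
  (rlmin_set_rank_function n P) m_max (rlmin_set1 n P) (ninv1 n) gf_unimodal.
split=> //; exists [seq r <- iota 2 (n - 2) | ~~ P (n - r)]; split.
- exact: sorted_filter ltn_trans _ _ (iota_ltn_sorted _ _).
- by apply/allP => r; rewrite mem_filter mem_iota; lia.
- rewrite -(prod_qint_iota (block_start0 hlam)); exact: rlmin_set_gf.
Qed.
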